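(* Let $\alpha\in\mathbb{R}$, $q\in[1,\infty)$, $s\in\{0,1,2,\dots\}$, and let $\mathcal{X}$ be either $\mathbb{R}^n$ or a cube $Q_0$ of $\mathbb{R}^n$. Then, for any $$f\in\bigcup_{r\in[1,\infty)}\bigcap_{p\in[r,\infty)}\widetilde{JN}_{(p,q,s)_\alpha}(\mathcal{X}),$$ it holds true that $$\lim_{p\to\infty}\|f\|_{\widetilde{JN}_{(p,q,s)_\alpha}(\mathcal{X})}=\|f\|_{\widetilde{\mathcal{C}}_{\alpha,q,s}(\mathcal{X})}$$ (where the right-hand side may be $\infty$).
   Context: A cube in $\mathbb{R}^n$ has finite positive edge length and edges parallel to the coordinate axes; it need not be open or closed. $\mathcal{X}$ denotes either $\mathbb{R}^n$ or a fixed cube $Q_0$ of $\mathbb{R}^n$. Functions are real-valued. $\fint_Q f:=\frac1{|Q|}\int_Q f$. $L^q_{\mathrm{loc}}(\mathcal{X})$ is the set of measurable $f$ on $\mathcal{X}$ with $f\mathbf 1_E\in L^q(\mathcal{X})$ for every bounded $E\subset\mathcal{X}$. For $s\in\{0,1,2,\dots\}$, a cube $Q$ and $f$ integrable on $Q$, $P^{(s)}_Q(f)$ is the unique polynomial of degree at most $s$ such that $\int_Q[f(x)-P^{(s)}_Q(f)(x)]x^\gamma\,dx=0$ for every multi-index $\gamma$ with $|\gamma|\le s$. For $f\in L^q_{\mathrm{loc}}(\mathcal{X})$ and $p\in[1,\infty)$, $$\|f\|_{\widetilde{JN}_{(p,q,s)_\alpha}(\mathcal{X})}:=\sup\left\{\sum_i|Q_i|\left[|Q_i|^{-\alpha}\left\{\fint_{Q_i}\left|f-P^{(s)}_{Q_i}(|f|)\right|^q\right\}^{1/q}\right]^p\right\}^{1/p},$$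 the supremum being over all collections $\{Q_i\}_i$ of cubes contained in $\mathcal{X}$ with pairwise disjoint interiors; $\widetilde{JN}_{(p,q,s)_\alpha}(\mathcal{X})$ is the set of $f\in L^q_{\mathrm{loc}}(\mathcal{X})$ for which this is finite. Also $$\|f\|_{\widetilde{\mathcal{C}}_{\alpha,q,s}(\mathcal{X})}:=\sup_{Q\subset\mathcal{X}}|Q|^{-\alpha}\left[\fint_Q\left|f-P^{(s)}_Q(|f|)\right|^q\right]^{1/q},$$ the supremum being over all cubes $Q\subset\mathcal{X}$. *)

(* Defs.v *)
From HB Require Import structures.
From mathcomp Require Import all_boot all_order all_algebra.
From mathcomp Require Import all_classical all_reals all_analysis.
From mathcomp Require mpoly.
Import (canonicals, coercions) mpoly.

Set Implicit Arguments.
Unset Strict Implicit.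
Unset Printing Implicit Defensive.

Import Order.TTheory GRing.Theory Num.Theory.
Import numFieldNormedType.Exports.

Local Open Scope classical_set_scope.
Local Open Scope ring_scope.

Fact rV_display : measure_display. Proof. exact: default_measure_display. Qed.

Section borel_rV.
Context {R : realType} (n : nat).

Let coord (i : 'I_n) (x : 'rV[R]_n) : measurableTypeR R := x ord0 i.

Let borel0 : g_sigma_preimage coord set0.
Proof. exact: sigma_algebra0. Qed.

Let borelC A : g_sigma_preimage coord A -> g_sigma_preimage coord (~` A).
Proof. exact: sigma_algebraC. Qed.

Let borel_bigcup (F : (set 'rV[R]_n)^nat) :
  (forall i, g_sigma_preimage coord (F i)) ->
  g_sigma_preimage coord (\bigcup_i (F i)).
Proof. exact: sigma_algebra_bigcup. Qed.

HB.instance Definition _ := @isMeasurable.Build rV_display 'rV[R]_n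
  (g_sigma_preimage coord) borel0 borelC borel_bigcup.

Lemma measurable_coord (i : 'I_n) :
  measurable_fun [set: 'rV[R]_n] (fun x : 'rV[R]_n => x ord0 i : measurableTypeR R).
Proof.
move=> _ Y mY; rewrite setTI; apply: sub_sigma_algebra => /=.
rewrite -bigcup_seq/=; exists i => /=; first by rewrite mem_index_enum.
by exists Y => //; rewrite setTI.
Qed.

Lemma measurable_fun_rV d (T : measurableType d) (f : T -> 'rV[R]_n) :
  (forall i, measurable_fun [set: T] (fun t => f t ord0 i : measurableTypeR R)) ->
  measurable_fun [set: T] f.
Proof.
move=> mf _ Y mY; rewrite setTI.
have : preimage_set_system setT f (g_sigma_preimage coord) (f @^-1` Y).
  by exists Y => //; rewrite setTI.
rewrite -g_sigma_preimage_comp.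
apply: (smallest_sub (sigma_algebra_measurable T)).
rewrite -bigcup_seq/=; apply: bigcup_sub => i _ A [B mB <-].
exact: mf.
Qed.

End borel_rV.

Section lebesgue_step.
Context {R : realType} (n : nat).
Local Open Scope ereal_scope.

Definition rV_cons (z : measurableTypeR R * 'rV[R]_n) : 'rV[R]_n.+1 :=
  row_mx (const_mx z.1 : 'rV[R]_1) z.2.

Definition rV_uncons (x : 'rV[R]_n.+1) : measurableTypeR R * 'rV[R]_n :=
  (x ord0 ord0, rsubmx (x : 'rV[R]_(1 + n))).

Lemma rV_consK : cancel rV_cons rV_uncons.
Proof.
move=> [a v]; rewrite /rV_uncons /rV_cons /= row_mxKr; congr (_, _).
transitivity (row_mx (const_mx a : 'rV_1) v ord0 (lshift n ord0)).
  by congr (row_mx _ _ _ _); exact: val_inj.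
by rewrite row_mxEl mxE.
Qed.

Lemma measurable_rV_cons : measurable_fun [set: measurableTypeR R * 'rV[R]_n] rV_cons.
Proof.
apply: measurable_fun_rV => i; case: (@split_ordP 1 n i) => j ->.
- rewrite (_ : (fun _ => _) = fst) //.
  by apply/funext => z; rewrite [LHS](row_mxEl (const_mx z.1)) mxE.
- rewrite (_ : (fun _ => _) = (fun x : 'rV[R]_n => x ord0 j) \o snd).
    exact: (measurableT_comp (measurable_coord j) measurable_snd).
  by apply/funext => z; exact: (row_mxEr (const_mx z.1)).
Qed.

Lemma measurable_rV_uncons : measurable_fun [set: 'rV[R]_n.+1] rV_uncons.
Proof.
apply: measurable_fun_pair; first exact: measurable_coord.
apply: measurable_fun_rV => i.
by under eq_fun do rewrite mxE; exact: measurable_coord.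
Qed.

Variable mu : {sigma_finite_measure set 'rV[R]_n -> \bar R}.

Definition lebesgue_step : set 'rV[R]_n.+1 -> \bar R :=
  pushforward (@lebesgue_measure R \x mu) rV_cons.

Let lebesgue_step0 : lebesgue_step set0 = 0.
Proof. by rewrite /lebesgue_step /pushforward preimage_set0 measure0. Qed.

Let lebesgue_step_ge0 A : 0 <= lebesgue_step A.
Proof. by apply: measure_ge0; exact: measurable_rV_cons. Qed.

Let lebesgue_step_sigma_additive : semi_sigma_additive lebesgue_step.
Proof. by apply: measure_semi_sigma_additive; exact: measurable_rV_cons. Qed.

HB.instance Definition _ := isMeasure.Build _ _ _ lebesgue_step
  lebesgue_step0 lebesgue_step_ge0 lebesgue_step_sigma_additive.

Let lebesgue_step_sigma_finite : sigma_finite setT lebesgue_step.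
Proof.
have /sigma_finiteP[F [TF ndF Foo]] := sigma_finiteT (@lebesgue_measure R).
have /sigma_finiteP[G [TG ndG Goo]] := sigma_finiteT mu.
exists (fun k => rV_uncons @^-1` (F k `*` G k)).
  rewrite -preimage_bigcup (_ : \bigcup_k _ = setT) ?preimage_setT//.
  rewrite -subTset => -[x y] _.
  have [i _ Fix] : (\bigcup_k F k) x by rewrite -TF.
  have [j _ Gjy] : (\bigcup_k G k) y by rewrite -TG.
  exists (maxn i j) => //; split => /=.
    by move: x Fix; exact/subsetPset/ndF/leq_maxl.
  by move: y Gjy; exact/subsetPset/ndG/leq_maxr.
move=> k; have [mF Fk] := Foo k; have [mG Gk] := Goo k; split.
  rewrite -[X in measurable X]setTI; apply: measurable_rV_uncons => //.
  exact: measurableX.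
rewrite /lebesgue_step /pushforward -comp_preimage.
rewrite (_ : rV_uncons \o rV_cons = id); last first.
  by apply/funext => z; exact: rV_consK.
by rewrite preimage_id product_measure1E// lte_mul_pinfty// ge0_fin_numE.
Qed.

HB.instance Definition _ := Measure_isSigmaFinite.Build _ _ _ lebesgue_step
  lebesgue_step_sigma_finite.

End lebesgue_step.

Fixpoint borel_lebesgue (R : realType) (n : nat) :
    {sigma_finite_measure set 'rV[R]_n -> \bar R} :=
  match n with
  | 0 => @dirac _ 'rV[R]_0 0 R
  | m.+1 => lebesgue_step (borel_lebesgue R m)
  end.

Lemma measurable_rV_box (R : realType) n (A : 'I_n -> set (measurableTypeR R)) :
  (forall i, measurable (A i)) ->
  measurable [set x : 'rV[R]_n | forall i, A i (x ord0 i)].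
Proof.
move=> mA.
rewrite (_ : [set _ | _] = \bigcap_(i in [set: 'I_n])
  ((fun x : 'rV[R]_n => x ord0 i) @^-1` A i)).
  apply: fin_bigcap_measurable => //= i _.
  by rewrite -[X in measurable X]setTI; exact: measurable_coord.
by apply/seteqP; split => [x Ax i _|x Ax i]; exact: Ax.
Qed.

Lemma borel_lebesgue_box (R : realType) n (A : 'I_n -> set (measurableTypeR R)) :
  (forall i, measurable (A i)) ->
  borel_lebesgue R n [set x | forall i, A i (x ord0 i)] =
  (\prod_(i < n) lebesgue_measure (A i))%E.
Proof.
elim: n => [|n IH] in A *.
  move=> _; rewrite big_ord0 /= diracE mem_set//= => i; by case: i.
move=> mA; rewrite big_ord_recl -IH//= /lebesgue_step /pushforward.
rewrite (_ : _ @^-1` _ = A ord0 `*`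
  [set x : 'rV[R]_n | forall i, A (lift ord0 i) (x ord0 i)]).
  by rewrite product_measure1E//; exact: (@measurable_rV_box R n (fun i => A (lift ord0 i))).
have c0 (z : measurableTypeR R * 'rV[R]_n) : rV_cons z ord0 ord0 = z.1.
  by case: z => a v; have [] := (rV_consK (a, v)).
have cS (z : measurableTypeR R * 'rV[R]_n) i : rV_cons z ord0 (lift ord0 i) = z.2 ord0 i.
  by rewrite -[RHS](row_mxEr (const_mx z.1 : 'rV_1)); congr (row_mx _ _ _ _); exact: val_inj.
apply/seteqP; split => z /= Az.
  by split => [|i]; [rewrite -c0|rewrite /= -cS].
case: Az => Az1 Az2 i; case: (unliftP ord0 i) => [j|] ->.
  by rewrite cS.
by rewrite c0.
Qed.

(* The Caratheodory sigma-algebra of the outer measure induced by the Borel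
   product measure: its measurable sets are the Lebesgue measurable sets. *)
Notation lebesgue_rV R n := (caratheodory_type (mu_ext (borel_lebesgue R n))).

Definition lebesgue (R : realType) (n : nat) : set (lebesgue_rV R n) -> \bar R :=
  @completed_measure_extension _ _ _ (borel_lebesgue R n).

HB.instance Definition _ (R : realType) (n : nat) := Measure.on (@lebesgue R n).

Lemma lebesgue_cube (R : realType) n (a : 'rV[R]_n) (l : R) (bl br : 'I_n -> bool) :
  0 < l ->
  @lebesgue R n [set x | forall i, x ord0 i \in
     Interval (BSide (bl i) (a ord0 i)) (BSide (br i) (a ord0 i + l))] =
  (l ^+ n)%:E.
Proof.
move=> l0.
pose A i : set (measurableTypeR R) :=
  [set` Interval (BSide (bl i) (a ord0 i)) (BSide (br i) (a ord0 i + l))].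
have mA i : measurable (A i) by exact: measurable_itv.
rewrite /lebesgue /completed_measure_extension/= measurable_mu_extE.
  rewrite [LHS](@borel_lebesgue_box R n A mA).
  transitivity (\prod_(i < n) l%:E)%E.
    apply: eq_bigr => i _; rewrite /A lebesgue_measure_itv/= lte_fin ltrDl l0.
    by rewrite -EFinB addrAC subrr add0r.
  by rewrite prodEFin prodr_const card_ord.
exact: (@measurable_rV_box R n A mA).
Qed.

Section JN.
Context {R : realType} {n : nat}.
Implicit Types (X Q : set 'rV[R]_n) (f g : 'rV[R]_n -> R).

Local Notation mu := (@lebesgue R n).

(* [BSide true] is a bound just before its argument and [BSide false] one just
   after it, so each side of the cube may be open, closed or half-open. *)
Definition cube Q := exists (a : 'rV[R]_n) (l : R) (bl br : 'I_n -> bool),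
  0 < l /\
  Q = [set x | forall i, x ord0 i \in
         Interval (BSide (bl i) (a ord0 i)) (BSide (br i) (a ord0 i + l))].

Definition vol Q : R := fine (mu Q).

Definition Lp X (q : R) g :=
  measurable_fun (X : set (lebesgue_rV R n)) (g : lebesgue_rV R n -> R) /\
  (\int[mu]_(x in X) (`|g x| `^ q)%:E < +oo)%E.

Definition Lp_loc X (q : R) f :=
  measurable_fun (X : set (lebesgue_rV R n)) (f : lebesgue_rV R n -> R) /\
  forall E : set 'rV[R]_n, measurable (E : set (lebesgue_rV R n)) ->
    bounded_set E -> E `<=` X -> Lp X q (f \* \1_E).

Definition polyproj_spec (s : nat) Q g (P : mpoly.mpoly n R) :=
  (mpoly.msize P <= s.+1)%N /\
  forall m : mpoly.multinom n, (mpoly.mdeg m <= s)%N ->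
    (\int[mu]_(x in Q) ((g x - mpoly.meval (x ord0) P) *
                        \prod_(i < n) x ord0 i ^+ m i)%:E = 0)%E.

Definition polyproj (s : nat) Q g : 'rV[R]_n -> R :=
  fun x => mpoly.meval (x ord0) (xget 0 (polyproj_spec s Q g)).

Local Open Scope ereal_scope.

Definition oscillation (alpha q : R) (s : nat) f Q : \bar R :=
  (vol Q `^ (- alpha))%:E *
  ((vol Q)^-1%:E *
     \int[mu]_(x in Q)
        (`|f x - polyproj s Q (fun y => `|f y|%R) x| `^ q)%:E) `^ q^-1.

Definition cube_collection X (C : set (set 'rV[R]_n)) :=
  (forall Q, C Q -> cube Q /\ Q `<=` X) /\ trivIset C (@interior 'rV[R]_n).

Definition JN_norm X (p q : R) (s : nat) (alpha : R) f : \bar R :=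
  ereal_sup [set (\esum_(Q in C)
                    ((vol Q)%:E * oscillation alpha q s f Q `^ p)) `^ p^-1
            | C in cube_collection X].

Definition JN X (p q : R) (s : nat) (alpha : R) : set ('rV[R]_n -> R) :=
  [set f | Lp_loc X q f /\ JN_norm X p q s alpha f < +oo].

Definition Campanato_norm X (alpha q : R) (s : nat) f : \bar R :=
  ereal_sup [set oscillation alpha q s f Q | Q in [set Q | cube Q /\ Q `<=` X]].

End JN.

(* Main.v *)
(* Write [N p] for the [JN]-norm and [M] for the Campanato norm.  A single cube is
   an admissible collection, so [N p >= |Q| `^ p^-1 * oscillation Q], which tends
   to [oscillation Q]; hence [liminf N p >= M].  Conversely, if all oscillations
   are at most [b], then [oscillation Q `^ p <= b `^ (p - r) * oscillation Q `^ r]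
   gives [N p <= b `^ (1 - r / p) * N r `^ (r / p)], which tends to [b] since
   [N r] is finite. *)
Require Import Defs.
From mathcomp Require Import all_boot all_order all_algebra.
From mathcomp Require Import all_classical all_reals all_analysis.
Import Order.TTheory GRing.Theory Num.Theory numFieldNormedType.Exports.
Local Open Scope classical_set_scope.
Local Open Scope ring_scope.

Lemma powR_inv_cvg1 (R : realType) (c : R) : 0 < c ->
  c `^ p^-1 @[p --> +oo] --> (1 : R).
Proof.
move=> c0.
have inv0 : (p^-1 : R) @[p --> +oo] --> (0 : R).
  apply/(gtr0_cvgV0 (f := id)); first exact: nbhs_pinfty_gt.
  exact: cvg_id.
rewrite (_ : (fun p => _) = (fun p => expR (p^-1 * ln c))); last first.
  by apply/funext => p; rewrite /powR gt_eqF.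
rewrite -expR0 -(mul0r (ln c)).
apply: continuous_cvg; first exact: continuous_expR.
exact: cvgMr_tmp.
Qed.

(** This separates the lower and the upper estimate. A finite [M] is trapped between [m - e] and
    [m + e]; for [M = +oo] the second hypothesis is vacuous and the first gives divergence. *)
Lemma ereal_cvg_between (R : realType) T (F : set_system T) (FF : Filter F)
    (h : T -> \bar R) (M : \bar R) : M != -oo%E ->
  (forall a : R, (a%:E < M)%E -> \forall t \near F, (a%:E < h t)%E) ->
  (forall b : R, (M < b%:E)%E -> \forall t \near F, (h t < b%:E)%E) ->
  h t @[t --> F] --> M.
Proof.
case: M => [m| |//] _ lo up; last first.
  apply/cvgeyPge => A; near do apply: ltW.
  by apply: lo; rewrite ltry.
have near_m (e : R) : 0 < e ->
    \forall t \near F, ((m - e)%:E < h t)%E /\ (h t < (m + e)%:E)%E.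
  by move=> e0; near do split; [apply: lo|apply: up];
    rewrite lte_fin ?gtrBl ?ltrDl.
apply/fine_cvgP; split.
  have := near_m 1 ltr01; apply: filterS => t [].
  by case: (h t).
apply/cvgrPdist_lt => e /near_m; apply: filterS => t [] /=.
case: (h t) => //= y; rewrite !lte_fin => ? ?.
by rewrite distrC ltr_distl; apply/andP.
Unshelve. all: by end_near. Qed.

Section weighted_sums.
Context {R : realType} {T : choiceType}.
Variables (w : T -> R) (g : T -> \bar R).
Hypotheses (w0 : forall x, 0 <= w x) (g0 : forall x, (0 <= g x)%E).
Local Open Scope ereal_scope.

(* For [w] the volume and [g] the oscillation, [wpnorm] below is the [JN]-norm and
   [ereal_sup (g @` E)] the Campanato norm. *)
Definition wpsum (C : set T) (p : R) := \esum_(x in C) ((w x)%:E * g x `^ p).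

Lemma wpsum_ge0 C p : 0 <= wpsum C p.
Proof. by apply: esum_ge0 => x _; rewrite mule_ge0 ?lee_fin ?poweR_ge0. Qed.

Lemma wpsum_le (C : set T) (p r b : R) : (1 <= r <= p)%R -> (0 <= b)%R ->
  (forall x, C x -> g x <= b%:E) -> wpsum C p <= (b `^ (p - r))%:E * wpsum C r.
Proof.
move=> /andP[r1 rp] b0 gb.
have r0 : (0 < r)%R by apply: lt_le_trans r1.
have p0 : (0 < p)%R by apply: lt_le_trans rp.
(* [\esum] is a supremum over finite subsets, so finite sums suffice. *)
apply: ge_ereal_sup => _ [A [finA AC] <-].
apply: (@le_trans _ _ ((b `^ (p - r))%:E * \sum_(x \in A) ((w x)%:E * g x `^ r))).
  rewrite ge0_mule_fsumr; last first.
    by move=> x; rewrite mule_ge0 ?lee_fin ?poweR_ge0.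
  apply: lee_fsum => // x /AC /gb; move: (g0 x); case: (g x) => [y| |]//.
  rewrite !poweR_EFin -!EFinM !lee_fin => y0 yb.
  (* Splitting the exponent is valid even at [y = 0], because the total exponent [p] is nonzero. *)
  have -> : (y `^ p = y `^ (p - r) * y `^ r)%R.
    by rewrite -powRD subrK// (gt_eqF p0).
  rewrite mulrCA ler_wpM2r ?mulr_ge0 ?powR_ge0//.
  by rewrite ge0_ler_powR ?nnegrE// subr_ge0.
rewrite lee_wpmul2l ?lee_fin ?powR_ge0//.
by apply: ereal_sup_ubound; exists A.
Qed.

(** [E] abstracts the cubes in [X] and [FF] the admissible collections. Singletons give the lower
    bound, the inclusion in [E] the upper one. *)
Variables (E : set T) (FF : set (set T)).
Hypotheses (FFE : forall C, FF C -> C `<=` E)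
  (FF1 : forall x, E x -> FF [set x]) (wE : forall x, E x -> (0 < w x)%R).

Definition wpnorm (p : R) := ereal_sup [set wpsum C p `^ p^-1 | C in FF].

Lemma near_wpnorm_gt (a : R) : a%:E < ereal_sup [set g x | x in E] ->
  \forall p \near +oo%R, a%:E < wpnorm p.
Proof.
move=> /ereal_sup_gt[_ [x Ex <-] ax].
(* [g x] may be [+oo]; a real [y] below it keeps the limit argument in [R]. *)
have [y ay yx] : exists2 y : R, (a < y)%R & y%:E <= g x.
  move: ax; case: (g x) => [y| |//]; rewrite ?lte_fin => ax; first by exists y.
  by exists (a + 1)%R; rewrite ?ltrDl ?leey.
have cvgy : ((w x `^ p^-1 * y)%R @[p --> +oo%R] --> (y : R))%classic.
  rewrite -[X in _ --> X]mul1r; apply: cvgMr_tmp; apply: powR_inv_cvg1.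
  exact: wE.
near=> p.
have p0 : (0 < p)%R by near: p; exact: nbhs_pinfty_gt.
apply: (@lt_le_trans _ _ (w x `^ p^-1 * y)%:E).
  by rewrite lte_fin; near: p; exact: cvgr_gt ay.
apply: (@le_trans _ _ (wpsum [set x] p `^ p^-1)); last first.
  by apply: ereal_sup_ubound; exists [set x] => //; exact: FF1.
rewrite /wpsum esum_set1 ?mule_ge0 ?lee_fin ?poweR_ge0//.
rewrite poweRM ?lee_fin ?poweR_ge0// -poweRrM divff ?gt_eqF// poweRe1//.
by rewrite poweR_EFin EFinM lee_wpmul2l ?lee_fin ?powR_ge0.
Unshelve. all: by end_near. Qed.

Lemma near_wpnorm_lt (r b : R) : (1 <= r)%R -> wpnorm r < +oo -> E !=set0 ->
  ereal_sup [set g x | x in E] < b%:E -> \forall p \near +oo%R, wpnorm p < b%:E.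
Proof.
move=> r1 Nr [x0 Ex0] gb.
have r0 : (0 < r)%R by apply: lt_le_trans r1.
have gE x : E x -> g x <= ereal_sup [set g x | x in E].
  by move=> Ex; apply: ereal_sup_ubound; exists x.
have [d d0 [gd db]] : exists2 d : R, (0 < d)%R &
    (forall x, E x -> g x <= d%:E) /\ (d < b)%R.
  have := le_trans (g0 x0) (gE _ Ex0).
  move: gb gE; case: ereal_sup => [m| |]//; rewrite lte_fin lee_fin => mb gE m0.
  exists ((m + b) / 2)%R; first by rewrite divr_gt0 ?ltr_wpDl ?(le_lt_trans m0 mb).
  split; last by rewrite midf_lt.
  by move=> x /gE /le_trans; apply; rewrite lee_fin ltW ?midf_lt.
have Nr0 : 0 <= wpnorm r.
  apply: (@le_trans _ _ (wpsum [set x0] r `^ r^-1)); first exact: poweR_ge0.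
  by apply: ereal_sup_ubound; exists [set x0] => //; exact: FF1.
(* A strictly positive bound, even if the norm vanishes, makes [c] below positive. *)
have [k k0 Nrk] : exists2 k : R, (0 < k)%R & wpnorm r <= k%:E.
  move: Nr Nr0; case: (wpnorm r) => [k| |]// _; rewrite lee_fin => k0.
  by exists (k + 1)%R; [rewrite ltr_wpDl|rewrite lee_fin lerDl].
(* Chosen so that [d]^ (p - r) * k [^ r = d]^ p * c[, whose]p[-th root]d * c [^ p^-1] tends to
   [d < b]. *)
pose c := (k `^ r / d `^ r)%R.
have c0 : (0 < c)%R by rewrite divr_gt0 ?powR_gt0.
have cvgd : ((d * c `^ p^-1)%R @[p --> +oo%R] --> (d : R))%classic.
  by rewrite -[X in _ --> X]mulr1; apply: cvgMl_tmp; exact: powR_inv_cvg1.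
near=> p.
have rp : (r <= p)%R by near: p; apply: nbhs_pinfty_ge; exact: num_real.
have p0 : (0 < p)%R by apply: lt_le_trans rp.
apply: (@le_lt_trans _ _ (d * c `^ p^-1)%:E); last first.
  by rewrite lte_fin; near: p; exact: cvgr_lt db.
apply: ge_ereal_sup => _ [C FC <-].
have Sr : wpsum C r <= (k `^ r)%:E.
  (* The sum is the [r]-th power of its [r]-th root, which the supremum [wpnorm r] dominates. *)
  rewrite -[leLHS]poweRe1 ?wpsum_ge0// -(mulVf (lt0r_neq0 r0)) poweRrM -poweR_EFin.
  apply: gt0_ler_poweR;
    rewrite ?in_itv/= ?poweR_ge0 ?leey ?lee_fin ?(ltW r0) ?(ltW k0)//.
  by apply: (le_trans _ Nrk); apply: ereal_sup_ubound; exists C.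
have Sp : wpsum C p <= (d `^ p * c)%:E.
  apply: (le_trans (@wpsum_le C p r d _ _ _)); rewrite ?r1 ?(ltW d0)//.
    by move=> x /(FFE _ FC) /gd.
  apply: (le_trans (lee_wpmul2l _ Sr)); first by rewrite lee_fin powR_ge0.
  rewrite lee_fin powRB ?(gt_eqF d0) ?implybT// /c.
  by rewrite mulrAC mulrA.
rewrite -[X in (X * _)%R]powRr1 ?(ltW d0)// -(divff (lt0r_neq0 p0)) powRrM.
rewrite -powRM ?powR_ge0 ?(ltW c0)// -poweR_EFin.
have dc0 : (0 <= d `^ p * c)%R by exact: mulr_ge0 (powR_ge0 d p) (ltW c0).
by apply: gt0_ler_poweR;
  rewrite ?in_itv/= ?wpsum_ge0 ?leey ?lee_fin ?invr_ge0 ?(ltW p0) ?dc0.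
Unshelve. all: by end_near. Qed.

Lemma wpnorm_cvg (r : R) : (1 <= r)%R -> wpnorm r < +oo -> E !=set0 ->
  wpnorm p @[p --> +oo%R] --> ereal_sup [set g x | x in E].
Proof.
move=> r1 Nr E0; apply: ereal_cvg_between.
(* A supremum over a nonempty set of nonnegative values is not [-oo]. *)
- case: E0 => x Ex; rewrite -ltNye (@lt_le_trans _ _ (g x))//.
    exact: lt_le_trans (g0 x).
  by apply: ereal_sup_ubound; exists x.
- exact: near_wpnorm_gt.
- by move=> b; exact: near_wpnorm_lt r1 Nr E0.
Qed.

End weighted_sums.

Lemma vol_ge0 (R : realType) (n : nat) (Q : set 'rV[R]_n) : 0 <= vol Q.
Proof. exact/fine_ge0/measure_ge0. Qed.

Lemma vol_cube_gt0 (R : realType) (n : nat) (Q : set 'rV[R]_n) :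
  cube Q -> 0 < vol Q.
Proof.
by move=> [a [l [bl [br [l0 ->]]]]]; rewrite /vol lebesgue_cube// exprn_gt0.
Qed.

Lemma oscillation_ge0 (R : realType) (n : nat) (alpha q : R) (s : nat)
    (f : 'rV[R]_n -> R) (Q : set 'rV[R]_n) : (0 <= oscillation alpha q s f Q)%E.
Proof. by rewrite mule_ge0 ?poweR_ge0// lee_fin powR_ge0. Qed.

Lemma cube_collection1 (R : realType) (n : nat) (X Q : set 'rV[R]_n) :
  cube Q -> Q `<=` X -> cube_collection X [set Q].
Proof. by move=> cQ QX; split => [_ ->//|_ _ -> ->]. Qed.

Theorem proposition3p2 (R : realType) (n : nat) (alpha q : R) (s : nat)
    (X : set 'rV[R]_n) (f : 'rV[R]_n -> R) :
  (0 < n)%N -> 1 <= q -> X = setT \/ cube X ->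
  (\bigcup_(r in [set r : R | 1 <= r])
        \bigcap_(p in [set p : R | r <= p]) JN X p q s alpha) f ->
  JN_norm X p q s alpha f @[p --> +oo] --> Campanato_norm X alpha q s f.
Proof.
(* Membership at [p = r] supplies the finite norm for the upper bound. *)
move=> _ _ XP [r /= r1 /(_ r (lexx r))[_ Nr]].
apply: (@wpnorm_cvg R _ (@vol R n) (oscillation alpha q s f) _ _
  [set Q | cube Q /\ Q `<=` X] (cube_collection X) _ _ _ r) => //.
- exact: vol_ge0.
- exact: oscillation_ge0.
- by move=> C [CX _] Q /CX.
- by move=> Q [cQ QX]; exact: cube_collection1.
- by move=> Q [cQ _]; exact: vol_cube_gt0.
(* Some cube lies in [X]: [X] itself, or the half-open unit cube at the origin when [X] is the whole
   space. *)
- case: XP => [->|cX]; last by exists X; split.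
  have [Q cQ] : exists Q : set 'rV[R]_n, cube Q.
    by eexists; exists 0, 1, xpredT, xpredT; split; [exact: ltr01|reflexivity].
  by exists Q; split.
Qed.
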